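(* Let $M_1$ and $M_2$ be matroids on a common finite ground set $E$ such that $M_2$ is a quotient of $M_1$, denote this quotient by $f: M_1 \twoheadrightarrow M_2$, and let $K$ be an infinite field. The following statements are equivalent: (1) the quotient $f$ is realizable over $K$; (2) the Higgs factorization of $f$ is realizable over $K$; (3) the Higgs major of $f$ is realizable over $K$.
   Context: All matroids have finite ground sets; $\operatorname{rk}$ denotes rank and $U_{r,n}$ is the uniform matroid of rank $r$ on $n$ elements. Quotients. If $M_1, M_2$ are matroids on the same ground set $E$, then $M_2$ is a quotient of $M_1$, written $f: M_1 \twoheadrightarrow M_2$, if every flat of $M_2$ is a flat of $M_1$. The nullity of $f$ is $k=\operatorname{rk}(M_1)-\operatorname{rk}(M_2)$. The nullity of $A\subseteq E$ (with respect to $f$) is $n(A)=\operatorname{rk}_{M_1}(A)-\operatorname{rk}_{M_2}(A)$. Higgs lifts and Higgs factorization. For a quotient $f: M_1\twoheadrightarrow M_2$ of nullity $k$ and $0\le i\le k$, the $i$-th Higgs lift $L^i(f)$ is the matroid on $E$ whose flats are the flats of $M_2$ together with the flats of $M_1$ of nullity strictly less than $i$ (it is known that this is a matroid). One has a chain of quotients of nullity one $M_1=L^k(f)\twoheadrightarrow L^{k-1}(f)\twoheadrightarrow\dots\twoheadrightarrow L^1(f)\twoheadrightarrow L^0(f)=M_2$; the sequence $(L^k(f),L^{k-1}(f),\dots,L^0(f))$ is the Higgs factorization of $f$. Higgs major. Let $S$ be a set of cardinality $k$ disjoint from $E$. The Higgs major of $f$ is the matroid on $E\cup S$ given by the $k$-th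 Higgs lift of the quotient $M_1\oplus U_{k,k}\twoheadrightarrow M_2\oplus U_{0,k}$, where $U_{k,k}$ and $U_{0,k}$ have ground set $S$. Realizability. A map $\varphi:E\to V$ into a $K$-vector space $V$ realizes a matroid $M$ on $E$ if $\dim V=\operatorname{rk}(M)$ and a subset $A\subseteq E$ is independent in $M$ if and only if the family $(\varphi(a))_{a\in A}$ is linearly independent. $M$ is realizable over $K$ if such a map exists. The quotient $f:M_1\twoheadrightarrow M_2$ is realizable over $K$ if there are maps $\varphi_i:E\to V_i$ realizing $M_i$ over $K$ ($i=1,2$) and a linear map $g:V_1\to V_2$ with $\varphi_2=g\circ\varphi_1$. A chain of quotients $N_0\twoheadrightarrow N_1\twoheadrightarrow\dots\twoheadrightarrow N_k$ on $E$ (in particular a factorization) is realizable over $K$ if there are maps $\varphi_i:E\to V_i$ realizing $N_i$ over $K$ for all $i$ and linear maps $g_i:V_{i-1}\to V_i$ with $\varphi_i=g_i\circ\varphi_{i-1}$ for $1\le i\le k$. *)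

(* Defs.v *)
From HB Require Import structures.
From mathcomp Require Import all_boot all_algebra.
From mathcomp Require Import zify.

Set Implicit Arguments.
Unset Strict Implicit.
Unset Printing Implicit Defensive.

Definition matroid_axiom (E : finType) (I : {set {set E}}) : bool :=
  [&& set0 \in I,
      [forall A in I, forall B : {set E}, (B \subset A) ==> (B \in I)] &
      [forall A in I, forall B in I, (#|A| < #|B|) ==>
         [exists x in B :\: A, x |: A \in I]]].

Record matroid (E : finType) := Matroid {
  indep : {set {set E}};
  matroidP : matroid_axiom indep
}.

HB.instance Definition _ (E : finType) := [isSub for @indep E].
HB.instance Definition _ (E : finType) := [Finite of matroid E by <:].

Definition rk (E : finType) (M : matroid E) (A : {set E}) : nat :=
  \max_(I in indep M | I \subset A) #|I|.

Definition rank (E : finType) (M : matroid E) : nat := rk M [set: E].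

Definition flats (E : finType) (M : matroid E) : {set {set E}} :=
  [set F : {set E} | [forall x, (x \notin F) ==> (rk M F < rk M (x |: F))]].

Section MatroidTheory.
Context {E : finType}.
Implicit Types (M : matroid E) (A B C I J F : {set E}) (x y : E).

Lemma indep0 M : set0 \in indep M.
Proof. by case/and3P: (matroidP M). Qed.

Lemma indepS M A B : B \subset A -> A \in indep M -> B \in indep M.
Proof.
case/and3P: (matroidP M) => _ /forall_inP h _ sBA hA.
by move/forallP: (h A hA) => /(_ B) /implyP /(_ sBA).
Qed.

Lemma indep_aug M A B : A \in indep M -> B \in indep M -> #|A| < #|B| ->
  exists x, [/\ x \in B, x \notin A & x |: A \in indep M].
Proof.
case/and3P: (matroidP M) => _ _ /forall_inP h hA hB lt.
move/forall_inP: (h A hA) => /(_ B hB) /implyP /(_ lt) /exists_inP [x].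
by rewrite inE => /andP [? ?] ?; exists x.
Qed.

Lemma rk_ge M A I : I \in indep M -> I \subset A -> #|I| <= rk M A.
Proof. by move=> hI sIA; rewrite /rk (bigmax_sup I) // hI sIA. Qed.

Lemma rk_basis M A : exists B, [/\ B \in indep M, B \subset A & #|B| = rk M A].
Proof.
have h0 : (set0 \in indep M) && (set0 \subset A) by rewrite indep0 sub0set.
rewrite /rk (bigmax_eq_arg set0) //.
by case: arg_maxnP => // B /andP [? ?] _; exists B.
Qed.

Lemma rk_leP M A n :
  (forall I, I \in indep M -> I \subset A -> #|I| <= n) -> rk M A <= n.
Proof. by move=> h; apply/bigmax_leqP => I /andP [? ?]; apply: h. Qed.

Lemma rk_le_card M A : rk M A <= #|A|.
Proof. by apply: rk_leP => I _; apply: subset_leq_card. Qed.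

Lemma rk0 M : rk M set0 = 0.
Proof. by apply/eqP; rewrite -leqn0 -[X in _ <= X](@cards0 E) rk_le_card. Qed.

Lemma rk_indep M A : (A \in indep M) = (rk M A == #|A|).
Proof.
apply/idP/eqP => [hA|].
  by apply/eqP; rewrite eqn_leq rk_le_card rk_ge.
have [B [hB sBA <-]] := rk_basis M A => eBA.
suff <- : B = A by [].
by apply/eqP; rewrite eqEcard sBA eBA leqnn.
Qed.

Lemma rkS M A B : A \subset B -> rk M A <= rk M B.
Proof.
by move=> sAB; apply: rk_leP => I hI sIA; apply: rk_ge => //; apply: subset_trans sAB.
Qed.

Lemma rkU1 M x A : rk M (x |: A) <= (rk M A).+1.
Proof.
apply: rk_leP => I hI sI; rewrite (cardsD1 x I).
have : #|I :\ x| <= rk M A.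
  apply: rk_ge; first by apply: indepS hI; apply: subsetDl.
  by rewrite subDset.
case: (x \in I) => /=; lia.
Qed.

Lemma rk_closure M A C : (forall x, x \in C -> rk M (x |: A) = rk M A) ->
  rk M (A :|: C) = rk M A.
Proof.
move=> h; apply/eqP; rewrite eqn_leq; apply/andP; split; last exact/rkS/subsetUl.
apply: rk_leP => J hJ sJ; rewrite leqNgt; apply/negP.
have [B [hB sBA eB]] := rk_basis M A; rewrite -eB => lt.
have [x [xJ xB hx]] := indep_aug hB hJ lt.
have le : #|B|.+1 <= rk M (x |: A).
  by have := rk_ge hx (setUS [set x] sBA); rewrite cardsU1 xB.
move: (subsetP sJ x xJ); rewrite inE => /orP [xA|/h e].
  move: le; have -> : x |: A = A by apply/setUidPr; rewrite sub1set.
  by rewrite eB ltnn.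
by move: le; rewrite e eB ltnn.
Qed.

Lemma rk_localU M A x y : rk M (x |: A) = rk M A -> rk M (y |: A) = rk M A ->
  rk M (x |: (y |: A)) = rk M A.
Proof.
move=> hx hy; rewrite setUA setUC; apply: rk_closure => z.
by rewrite !inE => /orP [] /eqP ->.
Qed.

Lemma rk_spanS M A B x : A \subset B -> rk M (x |: A) = rk M A ->
  rk M (x |: B) = rk M B.
Proof.
move=> sAB; move: {2}#|B :\: A| (leqnn #|B :\: A|) => n.
elim: n A sAB => [|n IH] A sAB.
  rewrite leqn0 cards_eq0 setD_eq0 => sBA.
  by have -> : B = A by apply/eqP; rewrite eqEsubset sBA.
have [e|[y]] := set_0Vmem (B :\: A); first by move=> _; apply: IH; rewrite // e cards0.
rewrite inE => /andP [yA yB] le e.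
apply: (IH (y |: A)).
- by rewrite subUset sub1set yB.
- move: le; rewrite (cardsD1 y) inE yA yB /=.
  have -> : B :\: (y |: A) = (B :\: A) :\ y by rewrite setDDl setUC.
  lia.
have l1 := rkU1 M y A; have l2 := rkS M (subsetUr [set y] A).
have l3 := rkU1 M y (x |: A).
have l4 := rkS M (subsetUr [set x] (y |: A)).
have [e2|ne] := eqVneq (rk M (y |: A)) (rk M A).
  by rewrite (rk_localU e e2).
have e5 : x |: (y |: A) = y |: (x |: A) by rewrite setUCA.
rewrite e5 in l4 *; move/eqP: ne; lia.
Qed.

Lemma flatsP M F :
  reflect (forall x, x \notin F -> rk M F < rk M (x |: F)) (F \in flats M).
Proof.
rewrite inE; apply: (iffP forallP) => h x; last by apply/implyP; apply: h.
by move/implyP: (h x).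
Qed.

Lemma flats_indep M A :
  reflect (forall x, x \in A -> exists F, [/\ F \in flats M, A :\ x \subset F & x \notin F])
          (A \in indep M).
Proof.
apply: (iffP idP) => [hA x xA|h].
  pose cl := [set y | rk M (y |: (A :\ x)) == rk M (A :\ x)].
  have hcl : A :\ x \subset cl.
    apply/subsetP => y hy; rewrite inE; apply/eqP; congr (rk M _).
    by apply/setUidPr; rewrite sub1set.
  have ecl : rk M cl = rk M (A :\ x).
    have <- : (A :\ x) :|: cl = cl by apply/setUidPr.
    by apply: rk_closure => y; rewrite inE => /eqP.
  exists cl; split=> //.
    apply/flatsP => y; rewrite inE ecl => ny.
    have l := rkS M (setUS [set y] hcl); have l' := rkS M (subsetUr [set y] (A :\ x)).
    by apply: leq_trans l; rewrite ltn_neqAle eq_sym ny.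
  rewrite inE setD1K //.
  move: (hA) (indepS (subsetDl A [set x]) hA); rewrite !rk_indep => /eqP -> /eqP ->.
  by rewrite (cardsD1 x A) xA add1n eqn_leq ltnn.
have [B [hB sBA eB]] := rk_basis M A.
suff <- : B = A by [].
apply/eqP; rewrite eqEsubset sBA; apply/subsetP => x xA.
apply: contraT => nxB.
have [F [fF sF nxF]] := h x xA.
have sB : B \subset F.
  apply: subset_trans sF; apply/subsetP => y yB; rewrite !inE (subsetP sBA) // andbT.
  by apply: contraNneq nxB => <-.
move/flatsP: fF => /(_ x nxF).
suff /(rk_spanS sB) -> : rk M (x |: B) = rk M B by rewrite ltnn.
apply/eqP; rewrite eqn_leq (rkS M (subsetUr _ _)) andbT.
move: (hB); rewrite rk_indep => /eqP ->; rewrite eB; apply: rkS.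
by rewrite subUset sub1set xA.
Qed.

Lemma flats_inj : injective (@flats E).
Proof.
move=> M N e; apply: val_inj; apply/setP => A /=.
by apply/flats_indep/flats_indep => h x /h; rewrite e.
Qed.

Lemma matroid_of_rank (r : {set E} -> nat) :
  r set0 = 0 ->
  (forall x A, r A <= r (x |: A) <= (r A).+1) ->
  (forall x y A, r (x |: A) = r A -> r (y |: A) = r A -> r (x |: (y |: A)) = r A) ->
  exists M : matroid E, forall A, rk M A = r A.
Proof.
move=> r0 rU rL.
have rind (P : {set E} -> {set E} -> Prop) :
    (forall A, P A A) -> (forall A B x, A \subset B -> P A B -> x \notin B -> P A (x |: B)) ->
    forall A B, A \subset B -> P A B.
  move=> PA PU A B; move: {2}#|B :\: A| (erefl #|B :\: A|) => n.
  elim: n B => [|n IH] B.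
    move=> /eqP; rewrite cards_eq0 setD_eq0 => sBA sAB.
    by have -> : B = A by apply/eqP; rewrite eqEsubset sBA.
  move=> en sAB; have [e|[y yBA]] := set_0Vmem (B :\: A).
    by move: en; rewrite e cards0.
  move: (yBA); rewrite inE => /andP [yA yB].
  have sA : A \subset B :\ y by rewrite subsetD1 sAB.
  rewrite -(setD1K yB); apply: PU => //; last by rewrite !inE eqxx.
  apply: IH => //; move: en; rewrite (cardsD1 y) yBA => -[<-].
  by rewrite setDDl setUC -setDDl.
have rS A B : A \subset B -> r A <= r B.
  move: A B; apply: rind => // A B x _ le _.
  by apply: leq_trans le _; case/andP: (rU x B).
have rcard A B : A \subset B -> r B + #|A| <= r A + #|B|.
  move: A B; apply: rind => // A B x _ le nx.
  rewrite cardsU1 nx; have /andP [_] := rU x B; lia.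
have rle A : r A <= #|A|.
  by have := rcard _ _ (sub0set A); rewrite r0 cards0 addn0 add0n.
have rspan A B x : A \subset B -> r (x |: A) = r A -> r (x |: B) = r B.
  move: A B; apply: rind => // A B y _ le _ /le e.
  have /andP [l1 l2] := rU y B; have /andP [l3 l4] := rU y (x |: B).
  have /andP [l5 _] := rU x (y |: B).
  have [e2|ne] := eqVneq (r (y |: B)) (r B).
    by rewrite (rL x y B e e2).
  have e5 : x |: (y |: B) = y |: (x |: B) by rewrite setUCA.
  rewrite e5 in l5 *; move/eqP: ne; lia.
have rcl A B : (forall x, x \in B -> r (x |: A) = r A) -> A \subset B -> r B = r A.
  move=> h sAB.
  have : forall C, C \subset B -> r (A :|: C) = r A.
    move=> C; move: {2}#|C| (erefl #|C|) => n; elim: n C => [|n IH] C.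
      by move=> /eqP; rewrite cards_eq0 => /eqP ->; rewrite setU0.
    have [->|[y yC]] := set_0Vmem C; first by rewrite cards0.
    rewrite (cardsD1 y) yC => -[en] sCB.
    rewrite -(setD1K yC) setUCA.
    have <- := IH (C :\ y) en (subset_trans (subsetDl _ _) sCB).
    by apply: (rspan A); [apply: subsetUl | apply: h; apply: (subsetP sCB)].
  by move/(_ B (subxx B)); have /setUidPr -> := sAB.
pose I := [set A | r A == #|A|].
have Iax : matroid_axiom I.
  apply/and3P; split.
  - by rewrite inE r0 cards0.
  - apply/forall_inP => A; rewrite inE => /eqP hA; apply/forallP => B.
    apply/implyP => sBA; rewrite inE eqn_leq rle /=.
    by have := rcard _ _ sBA; rewrite hA; lia.
  apply/forall_inP => A; rewrite inE => /eqP hA.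
  apply/forall_inP => B; rewrite inE => /eqP hB.
  apply/implyP => lt; apply: contraT => /exists_inPn h.
  have e : r (A :|: B) = r A.
    apply: rcl; last exact: subsetUl.
    move=> x; have [xA _|nxA] := boolP (x \in A).
      by have /setUidPr -> : [set x] \subset A by rewrite sub1set.
    rewrite inE (negPf nxA) /= => xB.
    have := h x; rewrite !inE nxA xB => /(_ isT).
    rewrite cardsU1 nxA; have /andP [] := rU x A; lia.
  have := rS _ _ (subsetUr A B); rewrite e; lia.
exists (Matroid Iax) => A; apply/eqP; rewrite eqn_leq; apply/andP; split.
  by apply: rk_leP => J /=; rewrite inE => /eqP <-; apply: rS.
have h0 : (set0 \in I) && (set0 \subset A) by rewrite inE r0 cards0 eqxx sub0set.
pose B := [arg max_(J > set0 | (J \in I) && (J \subset A)) #|J|].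
have [hB sBA maxB] : [/\ B \in I, B \subset A &
    forall J, J \in I -> J \subset A -> #|J| <= #|B|].
  rewrite /B; case: arg_maxnP => // J /andP [? ?] h; split => // J' ? ?.
  by apply: h; apply/andP.
have rB : r B = #|B| by move: hB; rewrite inE => /eqP.
have -> : r A = r B.
  apply: rcl => // x xA.
  have [xB|nxB] := boolP (x \in B).
    by have /setUidPr -> : [set x] \subset B by rewrite sub1set.
  have /andP [l1 l2] := rU x B; apply/eqP; rewrite eqn_leq l1 andbT leqNgt.
  apply/negP => lt.
  have : #|x |: B| <= #|B|.
    apply: maxB; last by rewrite subUset sub1set xA.
    rewrite inE cardsU1 nxB; lia.
  by rewrite cardsU1 nxB; lia.
by rewrite rB; apply: rk_ge.
Qed.

End MatroidTheory.

Definition is_quotient (E : finType) (M1 M2 : matroid E) : bool :=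
  flats M2 \subset flats M1.

(* Truncated subtraction is harmless when [M2] is a quotient of [M1], since then
   [rk M2 A <= rk M1 A] (see [rk_quotient]). *)
Definition set_nullity (E : finType) (M1 M2 : matroid E) (A : {set E}) : nat :=
  rk M1 A - rk M2 A.

Definition nullity (E : finType) (M1 M2 : matroid E) : nat :=
  rank M1 - rank M2.

Lemma quotient_span (E : finType) (M1 M2 : matroid E) (f : is_quotient M1 M2) (A : {set E}) (x : E) :
  rk M1 (x |: A) = rk M1 A -> rk M2 (x |: A) = rk M2 A.
Proof.
move=> e.
pose cl := [set y | rk M2 (y |: A) == rk M2 A].
have hcl : A \subset cl.
  apply/subsetP => y hy; rewrite inE; apply/eqP; congr (rk M2 _).
  by apply/setUidPr; rewrite sub1set.
have ecl : rk M2 cl = rk M2 A.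
  have <- : A :|: cl = cl by apply/setUidPr.
  by apply: rk_closure => y; rewrite inE => /eqP.
have fcl : cl \in flats M2.
  apply/flatsP => y; rewrite inE ecl => ny.
  have l := rkS M2 (setUS [set y] hcl); have l' := rkS M2 (subsetUr [set y] A).
  by apply: leq_trans l; rewrite ltn_neqAle eq_sym ny.
have [|/(flatsP _ _ (subsetP f _ fcl))] := boolP (x \in cl).
  by rewrite inE => /eqP.
by rewrite (rk_spanS hcl e) ltnn.
Qed.

Lemma set_ind_U1 (E : finType) (P : {set E} -> Prop) :
  P set0 -> (forall x (A : {set E}), x \notin A -> P A -> P (x |: A)) -> forall A, P A.
Proof.
move=> P0 PU A; move: {2}#|A| (erefl #|A|) => n; elim: n A => [|n IH] A.
  by move/eqP; rewrite cards_eq0 => /eqP ->.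
have [->|[y yA]] := set_0Vmem A; first by rewrite cards0.
rewrite (cardsD1 y) yA => -[en]; rewrite -(setD1K yA).
by apply: PU; rewrite ?inE ?eqxx //; apply: IH.
Qed.

Lemma rk_quotient (E : finType) (M1 M2 : matroid E) (f : is_quotient M1 M2) (A : {set E}) :
  rk M2 A <= rk M1 A.
Proof.
elim/set_ind_U1: A => [|x A _ IH]; first by rewrite !rk0.
have := rkS M1 (subsetUr [set x] A); have := rkU1 M2 x A.
have [e|/eqP] := eqVneq (rk M1 (x |: A)) (rk M1 A); last lia.
by rewrite e (quotient_span f e).
Qed.

Definition higgs_flats (E : finType) (M1 M2 : matroid E) (i : nat) : {set {set E}} :=
  flats M2 :|: [set F : {set E} in flats M1 | set_nullity M1 M2 F < i].

Lemma higgs_lift_exists (E : finType) (M1 M2 : matroid E) (f : is_quotient M1 M2) i :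
  exists L : matroid E, flats L == higgs_flats M1 M2 i.
Proof.
pose r A := minn (rk M1 A) (rk M2 A + i).
have U x A : [/\ rk M1 A <= rk M1 (x |: A) <= (rk M1 A).+1,
    rk M2 A <= rk M2 (x |: A) <= (rk M2 A).+1, rk M2 A <= rk M1 A,
    rk M2 (x |: A) <= rk M1 (x |: A) &
    rk M1 (x |: A) = rk M1 A -> rk M2 (x |: A) = rk M2 A].
  by split; rewrite ?rkS ?subsetUr ?rkU1 //; [exact: rk_quotient ..|exact: quotient_span].
have [||x y A|L hL] := @matroid_of_rank E r.
- by rewrite /r !rk0 min0n.
- by move=> x A; have [] := U x A; rewrite /r; lia.
- have [] := U x A; have [] := U y A; have [] := U x (y |: A).
  have := @rk_localU E M1 A x y; have := @rk_localU E M2 A x y; rewrite /r.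
  by lia.
exists L; apply/eqP/setP => F.
have -> : (F \in higgs_flats M1 M2 i) =
    (F \in flats M2) || ((F \in flats M1) && (set_nullity M1 M2 F < i)).
  by rewrite in_setU; congr (_ || _); rewrite inE.
apply/idP/orP.
  move=> /flatsP h.
  have [lt|ge] := ltnP (set_nullity M1 M2 F) i; [right|left].
    rewrite andbT; apply/flatsP => x /h; rewrite !hL /r.
    by have [] := U x F; move: lt; rewrite /set_nullity; lia.
  apply/flatsP => x /h; rewrite !hL /r.
  by have [] := U x F; move: ge; rewrite /set_nullity; lia.
case=> [h2|/andP [/flatsP h1 lt]]; apply/flatsP => x nx.
  move/flatsP: (subsetP f _ h2) => /(_ x nx); move/flatsP: h2 => /(_ x nx).
  by rewrite !hL /r; lia.
move: (h1 x nx); rewrite !hL /r.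
by have [] := U x F; move: lt; rewrite /set_nullity; lia.
Qed.

(* The matroid whose flats are [higgs_flats M1 M2 i]; it is unique by [flats_inj]. *)
Definition higgs_lift (E : finType) (M1 M2 : matroid E) (f : is_quotient M1 M2)
    (i : nat) : matroid E :=
  xchoose (higgs_lift_exists f i).

Lemma flats_higgs_lift (E : finType) (M1 M2 : matroid E) (f : is_quotient M1 M2) i :
  flats (higgs_lift f i) = higgs_flats M1 M2 i.
Proof. exact/eqP/(xchooseP (higgs_lift_exists f i)). Qed.

Lemma higgs_lift0 (E : finType) (M1 M2 : matroid E) (f : is_quotient M1 M2) :
  higgs_lift f 0 = M2.
Proof.
apply: flats_inj; rewrite flats_higgs_lift; apply/setP => F.
by rewrite in_setU [X in _ || X]inE andbF orbF.
Qed.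

Lemma set_nullityS (E : finType) (M1 M2 : matroid E) (f : is_quotient M1 M2)
    (A B : {set E}) : A \subset B -> set_nullity M1 M2 A <= set_nullity M1 M2 B.
Proof.
move=> sAB; have -> : B = A :|: B by apply/esym/setUidPr.
elim/set_ind_U1: B {sAB} => [|x B _]; first by rewrite setU0.
rewrite setUCA /set_nullity; set C := A :|: B.
have := quotient_span f (A := C) (x := x); have := rk_quotient f C.
have := rk_quotient f (x |: C); have := rkU1 M1 x C; have := rkU1 M2 x C.
by have := rkS M1 (subsetUr [set x] C); have := rkS M2 (subsetUr [set x] C); lia.
Qed.

Lemma higgs_lift_nullity (E : finType) (M1 M2 : matroid E) (f : is_quotient M1 M2) :
  higgs_lift f (nullity M1 M2) = M1.
Proof.
apply: flats_inj; rewrite flats_higgs_lift; apply/setP => F.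
rewrite in_setU [X in _ || X]inE.
have [lt|ge] := ltnP (set_nullity M1 M2 F) (nullity M1 M2).
  rewrite andbT; case: (F \in flats M1) (subsetP f F); rewrite ?orbT ?orbF //.
  by case: (F \in flats M2) => // /(_ isT).
rewrite andbF orbF; apply/idP/idP => [|/flatsP h]; first exact: (subsetP f).
apply/flatsP => x /h; have := set_nullityS f (subsetT (x |: F)).
move: ge; rewrite /set_nullity /nullity /rank.
by have := rk_quotient f F; have := rk_quotient f (x |: F); lia.
Qed.

Lemma is_quotient_higgs_lift (E : finType) (M1 M2 : matroid E)
    (f : is_quotient M1 M2) i :
  is_quotient (higgs_lift f i.+1) (higgs_lift f i).
Proof.
rewrite /is_quotient !flats_higgs_lift; apply: setUS; apply/subsetP => F.
by rewrite !inE => /andP [-> /=]; lia.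
Qed.

(* [j |-> L^(k-j)(f)], to be read for [j <= k], with [k] the nullity of [f]. *)
Definition higgs_factorization (E : finType) (M1 M2 : matroid E)
    (f : is_quotient M1 M2) (j : nat) : matroid E :=
  higgs_lift f (nullity M1 M2 - j).

Definition uniform_indep (S : finType) (r : nat) : {set {set S}} :=
  [set A : {set S} | #|A| <= r].

Lemma uniform_axiom (S : finType) r : matroid_axiom (uniform_indep S r).
Proof.
apply/and3P; split; first by rewrite inE cards0.
  apply/forall_inP => A; rewrite inE => hA; apply/forallP => B.
  by apply/implyP => /subset_leq_card s; rewrite inE (leq_trans s).
apply/forall_inP => A _; apply/forall_inP => B; rewrite inE => hB.
apply/implyP => lt; have [e|[x xBA]] := set_0Vmem (B :\: A).
  by move/eqP: e; rewrite setD_eq0 => /subset_leq_card; rewrite leqNgt lt.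
apply/exists_inP; exists x => //.
by move: xBA; rewrite !inE cardsU1 => /andP [-> _]; apply: leq_trans hB.
Qed.

(* [U_{r,n}] on a ground set [S] of cardinality [n] (for [r <= n]). *)
Definition uniform (S : finType) (r : nat) : matroid S :=
  Matroid (uniform_axiom S r).

Definition dsum_indep (E S : finType) (M : matroid E) (N : matroid S) :
    {set {set E + S}} :=
  [set A : {set E + S} | (inl @^-1: A \in indep M) && (inr @^-1: A \in indep N)].

Lemma card_sum_set (E S : finType) (A : {set E + S}) :
  #|A| = #|inl @^-1: A| + #|inr @^-1: A|.
Proof.
rewrite -!sum1_card big_sumType /=; congr (_ + _);
  by apply: eq_bigl => x; rewrite inE.
Qed.

Lemma preim_inl_U1l (E S : finType) (A : {set E + S}) x :
  inl @^-1: (inl x |: A) = x |: (inl @^-1: A).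
Proof. by apply/setP => y; rewrite !inE. Qed.

Lemma preim_inr_U1l (E S : finType) (A : {set E + S}) (x : E) :
  inr @^-1: (inl x |: A) = inr @^-1: A.
Proof. by apply/setP => y; rewrite !inE. Qed.

Lemma preim_inr_U1r (E S : finType) (A : {set E + S}) x :
  inr @^-1: (inr x |: A) = x |: (inr @^-1: A).
Proof. by apply/setP => y; rewrite !inE. Qed.

Lemma preim_inl_U1r (E S : finType) (A : {set E + S}) (x : S) :
  inl @^-1: (inr x |: A) = inl @^-1: A.
Proof. by apply/setP => y; rewrite !inE. Qed.

Lemma dsum_axiom (E S : finType) (M : matroid E) (N : matroid S) :
  matroid_axiom (dsum_indep M N).
Proof.
apply/and3P; split; first by rewrite inE !preimset0 !indep0.
  apply/forall_inP => A; rewrite inE => /andP [h1 h2]; apply/forallP => B.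
  by apply/implyP => s; rewrite inE (indepS _ h1) ?(indepS _ h2) ?preimsetS.
apply/forall_inP => A; rewrite inE => /andP [hA1 hA2].
apply/forall_inP => B; rewrite inE => /andP [hB1 hB2].
apply/implyP; rewrite !card_sum_set => lt.
have [lt1|ge1] := ltnP #|inl @^-1: A| #|inl @^-1: B|.
  have [x [xB xA hx]] := indep_aug hA1 hB1 lt1.
  apply/exists_inP; exists (inl x); first by move: xB xA; rewrite !inE => -> ->.
  by rewrite inE preim_inl_U1l preim_inr_U1l hx.
have lt2 : #|inr @^-1: A| < #|inr @^-1: B| by lia.
have [x [xB xA hx]] := indep_aug hA2 hB2 lt2.
apply/exists_inP; exists (inr x); first by move: xB xA; rewrite !inE => -> ->.
by rewrite inE preim_inl_U1r preim_inr_U1r hA1.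
Qed.

Definition dsum (E S : finType) (M : matroid E) (N : matroid S) : matroid (E + S)%type :=
  Matroid (dsum_axiom M N).

Lemma rk_dsum (E S : finType) (M : matroid E) (N : matroid S) (A : {set E + S}) :
  rk (dsum M N) A = rk M (inl @^-1: A) + rk N (inr @^-1: A).
Proof.
apply/eqP; rewrite eqn_leq; apply/andP; split.
  apply: rk_leP => I /=; rewrite inE => /andP [h1 h2] s.
  by rewrite card_sum_set leq_add // rk_ge // preimsetS.
have [B1 [hB1 s1 <-]] := rk_basis M (inl @^-1: A).
have [B2 [hB2 s2 <-]] := rk_basis N (inr @^-1: A).
pose B := [set z : E + S | match z with inl x => x \in B1 | inr y => y \in B2 end].
have e1 : inl @^-1: B = B1 by apply/setP => x; rewrite !inE.
have e2 : inr @^-1: B = B2 by apply/setP => x; rewrite !inE.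
rewrite -{1}e1 -e2 -card_sum_set; apply: rk_ge; first by rewrite inE e1 e2 hB1.
apply/subsetP => -[x|x]; rewrite inE.
  by move/(subsetP s1); rewrite inE.
by move/(subsetP s2); rewrite inE.
Qed.

Lemma flats_dsum (E S : finType) (M : matroid E) (N : matroid S) (F : {set E + S}) :
  (F \in flats (dsum M N)) =
  (inl @^-1: F \in flats M) && (inr @^-1: F \in flats N).
Proof.
apply/flatsP/andP => [h|[/flatsP h1 /flatsP h2] [x|x] nx].
- split; apply/flatsP => x; rewrite inE => /h; rewrite !rk_dsum.
    by rewrite preim_inl_U1l preim_inr_U1l ltn_add2r.
  by rewrite preim_inl_U1r preim_inr_U1r ltn_add2l.
- by rewrite !rk_dsum preim_inl_U1l preim_inr_U1l ltn_add2r h1 // inE.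
by rewrite !rk_dsum preim_inl_U1r preim_inr_U1r ltn_add2l h2 // inE.
Qed.

Lemma is_quotient_dsum (E S : finType) (M1 M2 : matroid E) (N1 N2 : matroid S) :
  is_quotient M1 M2 -> is_quotient N1 N2 ->
  is_quotient (dsum M1 N1) (dsum M2 N2).
Proof.
move=> fM fN; apply/subsetP => F; rewrite !flats_dsum => /andP [h1 h2].
by rewrite (subsetP fM) // (subsetP fN).
Qed.

Lemma is_quotient_uniform0 (S : finType) r : is_quotient (uniform S r) (uniform S 0).
Proof.
apply/subsetP => F /flatsP h; apply/flatsP => x /h; rewrite ltnNge => /negP [].
by apply: rk_leP => I; rewrite inE leqn0 => /eqP ->.
Qed.

(* The ground set [E + S] is the disjoint union of [E] and [S]; the intended use
   is [#|S| = nullity M1 M2]. *)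
Definition higgs_major (E : finType) (M1 M2 : matroid E) (f : is_quotient M1 M2)
    (S : finType) : matroid (E + S)%type :=
  let k := nullity M1 M2 in
  higgs_lift (is_quotient_dsum f (is_quotient_uniform0 S k)) k.

Definition realizes (K : fieldType) (E : finType) (M : matroid E)
    (V : vectType K) (phi : E -> V) : Prop :=
  \dim {:V} = rank M /\
  forall A : {set E}, (A \in indep M) = free [seq phi a | a <- enum A].

Definition realizable (K : fieldType) (E : finType) (M : matroid E) : Prop :=
  exists (V : vectType K) (phi : E -> V), realizes M phi.

Definition quotient_realizable (K : fieldType) (E : finType) (M1 M2 : matroid E)
    (f : is_quotient M1 M2) : Prop :=
  exists (V1 V2 : vectType K) (phi1 : E -> V1) (phi2 : E -> V2) (g : 'Hom(V1, V2)),
    [/\ realizes M1 phi1, realizes M2 phi2 & forall a, phi2 a = g (phi1 a)].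

(* The chain is [N 0, N 1, .., N k]; values of [N] beyond [k] are irrelevant. *)
Definition chain_realizable (K : fieldType) (E : finType) (k : nat)
    (N : nat -> matroid E) : Prop :=
  exists (V : nat -> vectType K) (phi : forall i, E -> V i),
    (forall i, i <= k -> realizes (N i) (@phi i)) /\
    (forall i, i < k ->
       exists g : 'Hom(V i, V i.+1), forall a, phi i.+1 a = g (phi i a)).

Definition higgs_factorization_realizable (K : fieldType) (E : finType)
    (M1 M2 : matroid E) (f : is_quotient M1 M2) : Prop :=
  chain_realizable K (nullity M1 M2) (higgs_factorization f).

Definition infinite_field (K : fieldType) : Prop :=
  ~ exists s : seq K, forall x : K, x \in s.

(* Main.v *)
(** The [i]-th Higgs lift has rank function [min (rk M1) (rk M2 + i)]. Given a
    realization [g : V1 -> V2] of [f], choose [k = #|S|] vectors of [lker g] in general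
    position with respect to all the flats spanned by subsets of [E], which is possible
    over an infinite field. Then the span of [A] and of [j] of these vectors has
    dimension [min (rk M1 A + j) (rk M2 A + k)]. Hence adjoining all the chosen vectors
    realizes the Higgs major, and dividing [V1] by the span of the first [j] of them
    realizes the [(k - j)]-th lift, compatibly for all [j]. Conversely, the vectors
    indexed by [S] in a realization of the Higgs major satisfy the same dimension
    formula, so that dividing by their span realizes [M2] as a quotient of [M1]. *)

Require Import Defs.
From mathcomp Require Import all_boot all_algebra.
From mathcomp Require Import zify.
From Stdlib Require Import Classical.

Set Implicit Arguments.
Unset Strict Implicit.
Unset Printing Implicit Defensive.

Import GRing.Theory.
Local Open Scope ring_scope.

(** * Rank functions of Higgs lifts and of the Higgs major *)

Section HiggsRank.
Variables (E : finType) (M1 M2 : matroid E) (f : is_quotient M1 M2).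

(** The truncation on the right is a matroid rank function. Its flats turn out to be those of the
    lift, and flats determine a matroid. *)
Lemma rk_higgs_lift i (A : {set E}) :
  rk (higgs_lift f i) A = minn (rk M1 A) (rk M2 A + i).
Proof.
pose r A := minn (rk M1 A) (rk M2 A + i).
have U x B : [/\ (rk M1 B <= rk M1 (x |: B) <= (rk M1 B).+1)%N,
    (rk M2 B <= rk M2 (x |: B) <= (rk M2 B).+1)%N, (rk M2 B <= rk M1 B)%N,
    (rk M2 (x |: B) <= rk M1 (x |: B))%N &
    rk M1 (x |: B) = rk M1 B -> rk M2 (x |: B) = rk M2 B].
  by split; rewrite ?rkS ?subsetUr ?rkU1 //; [exact: rk_quotient ..|exact: quotient_span].
have [||x y B|L hL] := @matroid_of_rank E r.
- by rewrite /r !rk0 min0n.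
- by move=> x B; have [] := U x B; rewrite /r; lia.
- have [] := U x B; have [] := U y B; have [] := U x (y |: B).
  have := @rk_localU E M1 B x y; have := @rk_localU E M2 B x y; rewrite /r.
  by lia.
suff -> : higgs_lift f i = L by rewrite hL.
apply: flats_inj; apply/setP => F; rewrite flats_higgs_lift in_setU [X in _ || X]inE.
have [/flatsP h2|/flatsP nh2] := boolP (F \in flats M2).
  apply/esym/flatsP => x nx.
  have /flatsP/(_ x nx) := subsetP f F (introT (flatsP _ _) h2).
  by move: (h2 x nx); rewrite !hL /r /=; lia.
apply/andP/flatsP => [[/flatsP h1 lt] x nx|h].
  by move: (h1 x nx); rewrite !hL /r; have [] := U x F; move: lt; rewrite /set_nullity; lia.
have [lt|ge] := ltnP (set_nullity M1 M2 F) i.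
  split=> //; apply/flatsP => x /h; rewrite !hL /r.
  by have [] := U x F; move: lt; rewrite /set_nullity; lia.
(* For nullity at least [i] the minimum at [F] is [rk M2 F + i], so its strict growth forces that of
   [rk M2]. *)
case: nh2 => x /h; rewrite !hL /r.
by have [] := U x F; move: ge; rewrite /set_nullity; lia.
Qed.

(** Set nullity is monotone, hence at most its value on the whole ground set. *)
Lemma rk_quotient_nullity (A : {set E}) : (rk M1 A <= rk M2 A + nullity M1 M2)%N.
Proof.
have := set_nullityS f (subsetT A); have := rk_quotient f A.
by have := rk_quotient f setT; rewrite /set_nullity /nullity /rank; lia.
Qed.

End HiggsRank.

Lemma rk_uniform (S : finType) r (A : {set S}) : rk (uniform S r) A = minn #|A| r.
Proof.
apply/eqP; rewrite eqn_leq; apply/andP; split.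
  apply: rk_leP => I; rewrite inE => le /subset_leq_card; lia.
have le : (minn #|A| r <= size (enum A))%N by rewrite -cardE geq_minl.
pose B := [set x in take (minn #|A| r) (enum A)].
have cB : #|B| = minn #|A| r.
  by rewrite cardsE (card_uniqP (take_uniq _ (enum_uniq _))) size_takel.
rewrite -{1}cB; apply: rk_ge; first by rewrite inE cB geq_minr.
by apply/subsetP => x; rewrite inE => /mem_take; rewrite mem_enum.
Qed.

Lemma rk_higgs_major (E S : finType) (M1 M2 : matroid E) (f : is_quotient M1 M2)
    (A : {set E + S}) :
    #|S| = nullity M1 M2 ->
  rk (higgs_major f S) A =
    minn (rk M1 (inl @^-1: A) + #|inr @^-1: A|) (rk M2 (inl @^-1: A) + #|S|).
Proof.
move=> cS; rewrite rk_higgs_lift !rk_dsum !rk_uniform -cS.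
have := max_card (inr @^-1: A : {set S}). lia.
Qed.

(** * Spans of vector families and realizations as dimension formulas *)

Section Span.
Variables (K : fieldType) (V : vectType K) (I : finType).
Implicit Types (phi : I -> V) (A B : {set I}).

Definition family_span phi A : {vspace V} := (\sum_(a in A) <[phi a]>)%VS.

Lemma family_spanE phi A : family_span phi A = <<[seq phi a | a <- enum A]>>%VS.
Proof. by rewrite span_def big_map big_enum. Qed.

Lemma mem_family_span phi A a : a \in A -> phi a \in family_span phi A.
Proof. by move=> aA; rewrite memvE (sumv_sup a). Qed.

Lemma family_span_subP phi A (U : {vspace V}) :
  reflect (forall a, a \in A -> phi a \in U) (family_span phi A <= U)%VS.
Proof. by apply: (iffP subv_sumP) => h a /h; rewrite memvE. Qed.

Lemma family_spanS phi A B : A \subset B -> (family_span phi A <= family_span phi B)%VS.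
Proof.
by move=> sAB; apply/family_span_subP => a aA; apply/mem_family_span/(subsetP sAB).
Qed.

Lemma family_spanU1 phi A a : a \notin A ->
  family_span phi (a |: A) = (<[phi a]> + family_span phi A)%VS.
Proof. by move=> nA; rewrite /family_span big_setU1. Qed.

Lemma dim_addv_line (U : {vspace V}) v : \dim (<[v]> + U) = ((v \notin U) + \dim U)%N.
Proof.
have [vU|nvU] := boolP (v \in U).
  by have /addv_idPr -> : (<[v]> <= U)%VS by rewrite -memvE.
have v0 : v != 0 by apply: contraNneq nvU => ->; apply: mem0v.
rewrite dimv_disjoint_sum ?dim_vline ?v0 //.
apply/eqP; rewrite -subv0; apply/subvP => u; rewrite memv_cap => /andP [/vlineP [c ->]].
by rewrite rpredZeq (negPf nvU) orbF => /eqP ->; rewrite scale0r mem0v.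
Qed.

Lemma free_family phi A :
  free [seq phi a | a <- enum A] = (\dim (family_span phi A) == #|A|).
Proof. by rewrite family_spanE /free size_map -cardE. Qed.

Lemma dim_family_span_le phi A : (\dim (family_span phi A) <= #|A|)%N.
Proof. by rewrite family_spanE cardE -(size_map phi) dim_span. Qed.

(** Independence determines rank on both sides: a basis of [A] in [M] already spans the image of
    [A], since a vector outside its span would enlarge it to an independent set. *)
Lemma realizesP (M : matroid I) phi :
  realizes M phi <->
  \dim {:V} = rank M /\ forall A, rk M A = \dim (family_span phi A).
Proof.
split=> -[dV h]; split=> // A; last by rewrite rk_indep h free_family.
have hd B : (B \in indep M) = (\dim (family_span phi B) == #|B|).
  by rewrite h free_family.
apply/eqP; rewrite eqn_leq; apply/andP; split.
  by apply: rk_leP => B; rewrite hd => /eqP <- /(family_spanS phi)/dimvS.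
have [B [hB sBA cB]] := rk_basis M A.
apply: leq_trans (_ : \dim (family_span phi B) <= _)%N; last first.
  by rewrite -cB dim_family_span_le.
apply/dimvS/family_span_subP => a aA.
have [aB|naB] := boolP (a \in B); first exact: mem_family_span.
apply: contraT => na; have : a |: B \in indep M.
  move: hB; rewrite !hd family_spanU1 // dim_addv_line na cardsU1 naB.
  by move=> /eqP ->.
move/rk_ge => /(_ A); rewrite subUset sub1set aA sBA => /(_ isT).
by rewrite cardsU1 naB cB ltnn.
Qed.

Lemma realizes_span (M : matroid I) phi :
  realizes M phi -> family_span phi setT = fullv.
Proof.
case/realizesP => dV h; apply/eqP.
by rewrite eqEdim subvf dV /rank h leqnn.
Qed.

End Span.

Lemma limg_family_span (K : fieldType) (V W : vectType K) (I : finType)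
    (g : 'Hom(V, W)) (phi : I -> V) A :
  (g @: family_span phi A)%VS = family_span (g \o phi) A.
Proof. by rewrite /family_span limg_sum; apply: eq_bigr => a _; rewrite limg_line. Qed.

(** * Quotient vector spaces and factorization of linear maps *)

Section Quotient.
Variables (K : fieldType) (V : vectType K) (W : {vspace V}).

(* A model of [V / W]: the image of an endomorphism with kernel [W]. *)
Let p : 'End(V) := (\1 - projv W)%VF.

Definition quotv : vectType K := subvs_of (limg p).
Definition quotv_map : 'Hom(V, quotv) := (linfun (vsproj (limg p)) \o p)%VF.

Let lker_p : lker p = W.
Proof.
apply/vspaceP => v; rewrite memv_ker /p add_lfunE opp_lfunE id_lfunE subr_eq0.
by apply/eqP/idP => [->|vW]; [exact: memv_proj | rewrite projv_id].
Qed.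

Lemma lker_quotv_map : lker quotv_map = W.
Proof.
rewrite -[RHS]lker_p; apply/vspaceP => v; rewrite !memv_ker comp_lfunE lfunE /=.
apply/eqP/eqP => [/(congr1 vsval)|->]; last exact: linear0.
by rewrite vsprojK ?memv_img ?memvf.
Qed.

Lemma dim_quotv_map (U : {vspace V}) : (\dim (quotv_map @: U) + \dim W = \dim (U + W))%N.
Proof.
have := limg_ker_dim quotv_map U; rewrite lker_quotv_map.
have := dimv_sum_cap U W; lia.
Qed.

Lemma dim_quotv : (\dim {:quotv} + \dim W = \dim {:V})%N.
Proof.
rewrite -(limg_ker_dim p fullv) capfv dimvf /= addnC; congr addn.
by rewrite lker_p.
Qed.

End Quotient.

(** The vectors [u] and [p^-1 (p u)] differ by an element of [lker p], which [q] kills. This yields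
    the maps between quotients by nested subspaces. *)
Lemma lfun_factor (K : fieldType) (U V W : vectType K) (p : 'Hom(U, V)) (q : 'Hom(U, W)) :
  (lker p <= lker q)%VS -> exists g : 'Hom(V, W), forall u, q u = g (p u).
Proof.
move=> s; exists (q \o p^-1)%VF => u; rewrite comp_lfunE.
apply/eqP; rewrite -subr_eq0 -linearB -memv_ker; apply: (subvP s).
by rewrite memv_ker linearB subr_eq0 /= limg_lfunVK ?memv_img ?memvf.
Qed.

(** * Vectors in general position over an infinite field *)

Section Generic.
Variables (K : fieldType) (K_infinite : infinite_field K) (V : vectType K).

(** Each condition excludes at most one scalar, so finitely many conditions exclude only a finite
    list. *)
Lemma infinite_avoid (I : eqType) (P : I -> K -> Prop) (r : seq I) :
  (forall i, i \in r -> forall t u, P i t -> P i u -> t = u) ->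
  exists t, forall i, i \in r -> ~ P i t.
Proof.
move=> h.
have [s hs] : exists s : seq K, forall i, i \in r -> forall t, P i t -> t \in s.
  elim: r h => [|i r IH] h; first by exists [::].
  have [|s hs] := IH; first by move=> j jr; apply: h; rewrite inE jr orbT.
  have [[c hc]|nc] := classic (exists c, P i c).
    exists (c :: s) => j; rewrite inE => /predU1P [-> t it|/hs ht t /ht].
      by rewrite (h i (mem_head _ _) t c) ?mem_head.
    by rewrite inE orbC => ->.
  exists s => j; rewrite inE => /predU1P [-> t ht|/hs//].
  by case: nc; exists t.
have [t ht] := not_all_ex_not _ _ (fun a => K_infinite (ex_intro _ s a)).
by exists t => i ir /(hs i ir).
Qed.

(** A vector space over an infinite field is not a finite union of proper subspaces; here these are
    the intersections of [N] with the members of [r]. *)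
Lemma avoid_subspaces (N : {vspace V}) (r : seq {vspace V}) :
  (forall U, U \in r -> ~~ (N <= U)%VS) ->
  exists2 v, v \in N & forall U, U \in r -> v \notin U.
Proof.
elim: r => [|U0 r IH] h; first by exists 0; rewrite ?mem0v.
have [|w wN hw] := IH; first by move=> U Ur; apply: h; rewrite inE Ur orbT.
have [wU0|nwU0] := boolP (w \in U0); last first.
  by exists w => // U; rewrite inE => /predU1P [->|/hw].
have [u uN nu] := subvPn (h U0 (mem_head _ _)).
(* The line through [w] in direction [u] meets each subspace at most once: two common points would
   put [u], and then also [w], into it, whereas [U0] misses [u] and the others miss [w]. *)
have [|t ht] := @infinite_avoid _ (fun (U : {vspace V}) t => t *: u + w \in U) (U0 :: r).
  move=> U Ur t t' hU hU'; apply/eqP; rewrite -subr_eq0; apply: contraTT isT => ne.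
  have uU : u \in U.
    have := memvB hU hU'; rewrite opprD addrACA subrr addr0 -scalerBl.
    by rewrite rpredZeq (negPf ne).
  move: Ur; rewrite inE => /predU1P [e|/hw]; first by rewrite -e uU in nu.
  suff -> : w \in U by [].
  by have := memvB hU (memvZ t uU); rewrite addrAC subrr add0r.
exists (t *: u + w); first by rewrite memvD ?memvZ.
by move=> U /ht /negP.
Qed.

Lemma generic_vectors (S : finType) (N : {vspace V}) (r : seq {vspace V}) :
  exists2 s : S -> V, (forall x, s x \in N) &
    forall U, U \in r -> forall T : {set S},
      \dim (U + family_span s T) = minn (\dim U + #|T|) (\dim (U + N)).
Proof.
(* The vectors are chosen one at a time; [R] holds the indices already treated, and the others may
   carry any vector of [N]. *)
suff /(_ setT) [s sN hs] : forall R : {set S}, exists2 s : S -> V, (forall x, s x \in N) &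
    forall U, U \in r -> forall T : {set S}, T \subset R ->
      \dim (U + family_span s T) = minn (\dim U + #|T|) (\dim (U + N)).
  by exists s => // U Ur T; apply: hs.
elim/set_ind_U1 => [|x R xR [s sN hs]].
  exists (fun=> 0) => [x|U Ur T]; first exact: mem0v.
  rewrite subset0 => /eqP ->; rewrite /family_span big_set0 cards0 addv0 addn0.
  by apply/esym/minn_idPl/dimvS/addvSl.
(* The new vector must avoid every span built so far that does not already contain [N]. *)
pose q := [seq W <- [seq (U + family_span s T)%VS | U <- r, T <- enum (powerset R)]
          | ~~ (N <= W)%VS].
have [|v vN hv] := @avoid_subspaces N q; first by move=> U; rewrite mem_filter => /andP [].
pose s' y := if y == x then v else s y.
have es (T : {set S}) : T \subset R -> family_span s' T = family_span s T.
  move=> sT; apply: eq_bigr => y yT; rewrite /s'; case: eqP => // e.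
  by rewrite -e (subsetP sT) in xR.
exists s' => [y|U Ur T sT]; first by rewrite /s'; case: eqP.
have [xT|nxT] := boolP (x \in T); last first.
  have sTR : T \subset R.
    apply/subsetP => y yT; have := subsetP sT y yT.
    by rewrite in_setU1 => /predU1P [e|//]; rewrite -e yT in nxT.
  by rewrite es // hs.
have sT' : T :\ x \subset R by rewrite subDset.
rewrite (cardsD1 x) xT -{1}(setD1K xT) family_spanU1 ?setD11 // es //.
rewrite /s' eqxx [(_ + (_ + _))%VS]addvA [(U + _)%VS]addvC -addvA dim_addv_line hs //.
set W := (U + family_span s (T :\ x))%VS.
have sWN : (W <= U + N)%VS.
  by apply/addvS => //; apply/family_span_subP => y _; apply: sN.
have dW := hs U Ur _ sT'.
(* Either [W] has reached [U + N] and the dimension stays at its cap, or [v] lies outside [W] and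
   raises the dimension by one, still within the cap. *)
have [sNW|nsNW] := boolP (N <= W)%VS.
  have eW : W = (U + N)%VS by apply/eqP; rewrite eqEsubv sWN subv_add addvSl sNW.
  rewrite (subvP sNW _ vN) /=; move: dW; rewrite -/W eW; lia.
have -> : v \notin W.
  apply: hv; rewrite mem_filter nsNW /=.
  by apply: (allpairs_f (fun U T => (U + family_span s T)%VS)); rewrite // mem_enum inE.
have lt : (\dim W < \dim (U + N))%N.
  rewrite ltn_neqAle dimvS // andbT; apply: contraNneq nsNW => e.
  have /eqP -> : W == (U + N)%VS by rewrite eqEdim sWN e leqnn.
  exact: addvSr.
move: dW lt; rewrite -/W; lia.
Qed.

End Generic.

(** * Kernel frames as the link between the three kinds of realization *)

Section Realizations.
Variables (K : fieldType) (E : finType) (M1 M2 : matroid E) (f : is_quotient M1 M2).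
Variables (S : finType) (S_card : #|S| = nullity M1 M2).

(* [s] behaves like a generic basis of the kernel of a linear map realizing [f]:
   equivalently, [phi] and [s] together realize the Higgs major. *)
Definition kernel_frame (V : vectType K) (phi : E -> V) (s : S -> V) : Prop :=
  \dim {:V} = rank M1 /\
  forall (A : {set E}) (T : {set S}),
    \dim (family_span phi A + family_span s T) = minn (rk M1 A + #|T|) (rk M2 A + #|S|).

Lemma dim_frame (V : vectType K) (phi : E -> V) (s : S -> V) (T : {set S}) :
  kernel_frame phi s -> \dim (family_span s T) = #|T|.
Proof.
move=> [_ /(_ set0 T)]; rewrite /family_span big_set0 add0v !rk0 => ->.
by rewrite !add0n; apply/minn_idPl/max_card.
Qed.

(** Dividing by the span of the [T]-vectors subtracts [#|T|] from the frame formula, which leaves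
    the rank function of the lift. *)
Lemma kernel_frame_realizes (V : vectType K) (phi : E -> V) (s : S -> V) (T : {set S}) :
  kernel_frame phi s ->
  realizes (higgs_lift f (#|S| - #|T|)) (quotv_map (family_span s T) \o phi).
Proof.
move=> h; have dT := dim_frame T h; have cT : (#|T| <= #|S|)%N := max_card (mem T).
case: h => dV h; apply/realizesP; split=> [|A].
  have := dim_quotv (family_span s T); have := rk_quotient f setT.
  have := rk_quotient_nullity f setT; have := S_card.
  rewrite {1}/nullity /rank rk_higgs_lift -S_card dT dV /rank; lia.
have := dim_quotv_map (family_span s T) (family_span phi A).
rewrite limg_family_span h rk_higgs_lift dT; lia.
Qed.

Lemma kernel_frame_source (V : vectType K) (phi : E -> V) (s : S -> V) :
  kernel_frame phi s -> realizes M1 phi.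
Proof.
move=> [dV h]; apply/realizesP; split=> // A.
have := h A set0; rewrite {2}/family_span big_set0 addv0 cards0 addn0 => ->.
by apply/esym/minn_idPl; rewrite S_card rk_quotient_nullity.
Qed.

Lemma kernel_frame_quotient (V : vectType K) (phi : E -> V) (s : S -> V) :
  kernel_frame phi s -> quotient_realizable K f.
Proof.
move=> h; exists V, (quotv (family_span s setT)), phi.
exists (quotv_map (family_span s setT) \o phi), (quotv_map (family_span s setT)).
split=> //; first exact: kernel_frame_source h.
by have := kernel_frame_realizes setT h; rewrite cardsT subnn higgs_lift0.
Qed.

Lemma kernel_frame_factorization (V : vectType K) (phi : E -> V) (s : S -> V) :
  kernel_frame phi s -> higgs_factorization_realizable K f.
Proof.
(* Increasing sets of size [j] give nested kernels, so each quotient maps onto the next. *)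
move=> h; pose T j : {set S} := [set x in take j (enum S)].
exists (fun j => quotv (family_span s (T j))).
exists (fun j => quotv_map (family_span s (T j)) \o phi); split=> j lej.
  have cT : #|T j| = j.
    rewrite cardsE (card_uniqP (take_uniq _ (enum_uniq _))) size_takel //.
    by rewrite -cardE S_card.
  by rewrite /higgs_factorization -S_card -{1}cT; apply: kernel_frame_realizes.
have [|g hg] := @lfun_factor _ _ _ _ (quotv_map (family_span s (T j)))
    (quotv_map (family_span s (T j.+1))).
  rewrite !lker_quotv_map; apply/family_spanS/subsetP => x; rewrite !inE.
  by rewrite -(take_takel (enum S) (leqnSn j)); apply: mem_take.
by exists g => a; apply: hg.
Qed.

Lemma family_span_sum (V : vectType K) (psi : E + S -> V) (A : {set E + S}) :
  family_span psi A =
    (family_span (psi \o inl) (inl @^-1: A) + family_span (psi \o inr) (inr @^-1: A))%VS.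
Proof.
by rewrite /family_span big_sumType; congr (_ + _)%VS; apply: eq_bigl => x; rewrite inE.
Qed.

Lemma rank_higgs_major : rank (higgs_major f S) = rank M1.
Proof.
rewrite /rank rk_higgs_major // !preimsetT cardsT S_card.
have := rk_quotient f setT; have := rk_quotient_nullity f setT.
rewrite /nullity /rank; lia.
Qed.

(** Subsets of [E + S] are pairs of subsets, and for these the frame formula is the rank function of
    the Higgs major. *)
Lemma kernel_frame_major (V : vectType K) (psi : E + S -> V) :
  kernel_frame (psi \o inl) (psi \o inr) <-> realizes (higgs_major f S) psi.
Proof.
split=> [[dV h]|/realizesP [dV h]].
  apply/realizesP; split=> [|A]; first by rewrite rank_higgs_major.
  by rewrite family_span_sum h rk_higgs_major.
split=> [|A T]; first by rewrite -rank_higgs_major.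
pose B := [set z : E + S | match z with inl x => x \in A | inr y => y \in T end].
have eA : inl @^-1: B = A by apply/setP => x; rewrite !inE.
have eT : inr @^-1: B = T by apply/setP => x; rewrite !inE.
by have := h B; rewrite family_span_sum rk_higgs_major // eA eT.
Qed.

(** Generic vectors of [lker g] work: for [U] the span of [A], [U + lker g] has dimension
    [rk M2 A + \dim (lker g)]. *)
Lemma quotient_kernel_frame (K_infinite : infinite_field K) :
  quotient_realizable K f ->
  exists (V : vectType K) (phi : E -> V) (s : S -> V), kernel_frame phi s.
Proof.
move=> [V1 [V2 [phi1 [phi2 [g [r1 r2 hg]]]]]].
have [s _ hs] := generic_vectors K_infinite S (lker g)
  [seq family_span phi1 A | A <- enum [set: {set E}]].
have s1 := realizes_span r1.
case/realizesP: r1 => d1 h1; case/realizesP: r2 => d2 h2.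
have eg A : (g @: family_span phi1 A)%VS = family_span phi2 A.
  by rewrite limg_family_span; apply: eq_bigr => a _; rewrite /= hg.
exists V1, phi1, s; split=> // A T.
rewrite hs ?map_f ?mem_enum ?inE // -h1; congr minn.
have := limg_ker_dim g (family_span phi1 A); rewrite eg -h1 -h2.
have := dimv_sum_cap (family_span phi1 A) (lker g); rewrite -h1.
(* As [phi1] spans [V1], rank-nullity for [g] gives [lker g] dimension [rank M1 - rank M2], which is
   [#|S|]. *)
have := limg_ker_dim g fullv; rewrite capfv -s1 eg -h1 -h2 S_card /nullity /rank.
lia.
Qed.

(** The composite of the chain maps links its two ends, which are [M1] and [M2]. *)
Lemma factorization_quotient :
  higgs_factorization_realizable K f -> quotient_realizable K f.
Proof.
move=> [V [phi [real_phi step]]]; set k := nullity M1 M2 in real_phi step.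
have [g hg] : exists g : 'Hom(V 0, V k), forall a, phi k a = g (phi 0 a).
  elim: k {real_phi} step => [|k IH] step; first by exists \1%VF => a; rewrite lfunE.
  have [g hg] := IH (fun i lt => step i (ltnW lt)).
  have [g' hg'] := step k (ltnSn k).
  by exists (g' \o g)%VF => a; rewrite comp_lfunE -hg -hg'.
exists (V 0), (V k), (phi 0), (phi k), g; split=> //.
  by have := real_phi 0 (leq0n k); rewrite /higgs_factorization subn0 higgs_lift_nullity.
by have := real_phi k (leqnn k); rewrite /higgs_factorization subnn higgs_lift0.
Qed.

End Realizations.

Theorem theoremA (E : finType) (M1 M2 : matroid E) (f : is_quotient M1 M2)
    (K : fieldType) (K_infinite : infinite_field K)
    (S : finType) (S_card : #|S| = nullity M1 M2) :
  [<-> quotient_realizable K f;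
       higgs_factorization_realizable K f;
       realizable K (higgs_major f S)].
Proof.
tfae.
- case/(quotient_kernel_frame S_card K_infinite) => V [phi [s h]].
  exact: (kernel_frame_factorization f S_card h).
(* The Higgs major is reached through a realization of [f] itself, from which a fresh frame is
   chosen. *)
- move/factorization_quotient.
  case/(quotient_kernel_frame S_card K_infinite) => V [phi [s h]].
  exists V, (fun z => match z with inl a => phi a | inr x => s x end).
  exact/kernel_frame_major.
- by move=> [V [psi /(kernel_frame_major f S_card)/(kernel_frame_quotient f S_card)]].
Qed.
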